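(* Let $1\le k<n$, $m+1=\binom{n}{k}$, and let $\mathbf b,\mathbf c\in(\mathbb Z_{\ge1})^{m+1}$ be Plücker weight vectors for $k<n$. Suppose $\mathbf b$ and $\mathbf c$ differ by a Plücker permutation and a scalar multiplication, i.e. there exist a Plücker permutation $\sigma$ of $\{0,1,\dots,m\}$ and positive integers $r,s$ with $r\,\mathbf c=s\,\sigma\mathbf b$. Then the weighted Grassmann orbifolds $\mathrm{Gr}_{\mathbf b}(k,n)$ and $\mathrm{Gr}_{\mathbf c}(k,n)$ are weakly equivariantly homeomorphic: there is a homeomorphism $f:\mathrm{Gr}_{\mathbf b}(k,n)\to\mathrm{Gr}_{\mathbf c}(k,n)$ that is equivariant with respect to the standard $(\mathbb C^* )^n$-action on $\mathrm{Gr}_{\mathbf b}(k,n)$ and the $\sigma$-permuted $(\mathbb C^* )^n$-action on $\mathrm{Gr}_{\mathbf c}(k,n)$.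
   Context: Let $1\le k<n$ and $m+1=\binom nk$. A Schubert symbol for $k<n$ is a sequence $\lambda=(\lambda_1<\dots<\lambda_k)$ of integers in $\{1,\dots,n\}$ (identified with its underlying set). Write $\lambda\preceq\mu$ iff $\lambda_i\le\mu_i$ for all $i$, and fix a total order $\lambda^0<\lambda^1<\dots<\lambda^m$ of all Schubert symbols refining $\preceq$. With $e_1,\dots,e_n$ the standard basis of $\mathbb C^n$ and $e_\lambda=e_{\lambda_1}\wedge\dots\wedge e_{\lambda_k}$, identify $\Lambda^k(\mathbb C^n)$ with $\mathbb C^{m+1}$ by $z=\sum_i z_ie_{\lambda^i}$. Let $Pl(k,n)=\{a_1\wedge\dots\wedge a_k: a_i\in\mathbb C^n\}\setminus\{0\}$. $\mathbf b=(b_0,\dots,b_m)\in(\mathbb Z_{\ge1})^{m+1}$ is a Plücker weight vector if for all $1\le i_1<\dots<i_{k-1}\le n$ and $1\le\ell_0<\dots<\ell_k\le n$ the sum $b_{r_j}+b_{s_j}$ takes the same value for all $j\in\{0,\dots,k\}$ with $\ell_j\notin\{i_1,\dots,i_{k-1}\}$, where $\lambda^{r_j}=\{i_1,\dots,i_{k-1},\ell_j\}$ and $\lambda^{s_j}=\{\ell_0,\dots,\ell_k\}\setminus\{\ell_j\}$. For such $\mathbf b$, $\mathbb C^*$ acts on $Pl(k,n)$ by $t(z_0,\dots,z_m)=(t^{b_0}z_0,\dots,t^{b_m}z_m)$, and $\mathrm{Gr}_{\mathbf b}(k,n)$ is the orbit space with the quotient topology (a weighted Grassmann orbifold); $[z]$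 is the class of $z$. A permutation $\sigma$ of $\{0,\dots,m\}$ is a Plücker permutation if there is $t_\sigma=(t_0,\dots,t_m)\in\{1,-1\}^{m+1}$ such that $(t_0z_{\sigma(0)},\dots,t_mz_{\sigma(m)})\in Pl(k,n)$ for every $z\in Pl(k,n)$. Put $\sigma\mathbf b=(b_{\sigma(0)},\dots,b_{\sigma(m)})$. For a Schubert symbol $\lambda$ and $t\in(\mathbb C^* )^n$ put $t_\lambda=t_{\lambda_1}\cdots t_{\lambda_k}$. The standard $(\mathbb C^* )^n$-action is $t\cdot[(z_i)_i]=[(t_{\lambda^i}z_i)_i]$; the $\sigma$-permuted action is $t\cdot_\sigma[(z_i)_i]=[(t_{\lambda^{\sigma(i)}}z_i)_i]$. *)

(* Defs.v *)
Set Warnings "-all".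
From HB Require Import structures.
From mathcomp Require Import all_boot all_order all_algebra all_fingroup.
From mathcomp Require Import complex.
From mathcomp Require Import all_classical all_reals all_analysis.

Set Implicit Arguments.
Unset Strict Implicit.
Unset Printing Implicit Defensive.

Import Order.TTheory GRing.Theory Num.Theory.
Import numFieldNormedType.Exports.

Local Open Scope classical_set_scope.
Local Open Scope ring_scope.
Local Open Scope quotient_scope.

(* The topology of the modulus on the complex numbers R[i]; the spaces
   'rV[R[i]]_N then carry the product topology. *)
HB.instance Definition _ (R : realType) := NormedModule.copy R[i] R[i]^o.

Definition homeomorphism (X Y : topologicalType) (f : X -> Y) : Prop :=
  continuous f /\
  exists g : Y -> X, [/\ cancel f g, cancel g f & continuous g].

(* Schubert symbols are increasing sequences in {0, ..., n-1} instead of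
   {1, ..., n}; the shift is harmless since only the order of the entries
   matters. *)
Definition schubert (k n : nat) : Type :=
  {l : k.-tuple 'I_n | sorted (fun i j : 'I_n => (i < j)%N) l}.

Definition entry (k n : nat) (l : schubert k n) (a : 'I_k) : 'I_n :=
  tnth (val l) a.

Definition support_set (k n : nat) (l : schubert k n) : {set 'I_n} :=
  [set x in val l]%SET.

Definition schubert_le (k n : nat) (l l' : schubert k n) : Prop :=
  forall a : 'I_k, (entry l a <= entry l' a)%N.

(* A total order lam 0 < ... < lam m on all Schubert symbols refining
   schubert_le is given as its increasing enumeration. *)
Definition schubert_order (k n m : nat) (lam : 'I_m.+1 -> schubert k n) : Prop :=
  bijective lam /\
  forall i j : 'I_m.+1, schubert_le (lam i) (lam j) -> (i <= j)%N.

Definition plucker_weight (k n m : nat) (lam : 'I_m.+1 -> schubert k n)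
    (b : 'I_m.+1 -> nat) : Prop :=
  (forall i, 0 < b i)%N /\
  forall (I : schubert k.-1 n) (L : schubert k.+1 n) (j j' : 'I_k.+1)
         (r s r' s' : 'I_m.+1),
    entry L j \notin support_set I ->
    support_set (lam r) = (entry L j |: support_set I)%SET ->
    support_set (lam s) = (support_set L :\ entry L j)%SET ->
    entry L j' \notin support_set I ->
    support_set (lam r') = (entry L j' |: support_set I)%SET ->
    support_set (lam s') = (support_set L :\ entry L j')%SET ->
    (b r + b s = b r' + b s')%N.

Section WeightedGrassmann.
Variables (R : realType) (k n m : nat) (lam : 'I_m.+1 -> schubert k n).
Local Notation C := R[i].
Implicit Types (z w : 'rV[C]_m.+1) (b : 'I_m.+1 -> nat) (s : 'S_m.+1).

(* Coordinates in the basis (e_(lam i))_i of a_1 /\ ... /\ a_k, where a_1, ...,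
   a_k are the rows of A: expanding the product multilinearly, the coefficient
   of e_(lam i) is the minor of A on the columns lam i.  The lemmas
   wedge_multilinear, wedge_alternate and wedge_basis below characterize this
   map: it is multilinear, alternating, and sends
   (e_(lam i)_1, ..., e_(lam i)_k) to the i-th coordinate vector. *)
Definition wedge (A : 'M[C]_(k, n)) : 'rV[C]_m.+1 :=
  \row_i \det (colsub (entry (lam i)) A).

Lemma wedge_multilinear (A B D : 'M[C]_(k, n)) (a0 : 'I_k) (x y : C) :
  row a0 A = x *: row a0 B + y *: row a0 D ->
  row' a0 B = row' a0 A -> row' a0 D = row' a0 A ->
  wedge A = x *: wedge B + y *: wedge D.
Proof.
move=> /rowP eqA /matrixP eqB /matrixP eqD; apply/rowP => i; rewrite !mxE.
apply: (determinant_multilinear (i0 := a0)).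
- by apply/rowP => c; have := eqA (entry (lam i) c); rewrite !mxE.
- by apply/matrixP => a c; have := eqB a (entry (lam i) c); rewrite !mxE.
- by apply/matrixP => a c; have := eqD a (entry (lam i) c); rewrite !mxE.
Qed.

Lemma wedge_alternate (A : 'M[C]_(k, n)) (a1 a2 : 'I_k) :
  a1 != a2 -> row a1 A = row a2 A -> wedge A = 0.
Proof.
move=> a12 /rowP eqA; apply/rowP => i; rewrite !mxE.
apply: (determinant_alternate a12) => c.
by have := eqA (entry (lam i) c); rewrite !mxE.
Qed.

Lemma entry_mono (l : schubert k n) (a c : 'I_k) :
  (a < c)%N -> (entry l a < entry l c)%N.
Proof.
move=> ac; have n0 : 'I_n := entry l a.
rewrite /entry !(tnth_nth n0).
apply: (sorted_ltn_nth (leT := fun i j : 'I_n => (i < j)%N)) => //.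
- by move=> x y u; apply: ltn_trans.
- exact: (valP l).
- by rewrite inE size_tuple.
- by rewrite inE size_tuple.
Qed.

Lemma entry_inj (l : schubert k n) : injective (entry l).
Proof.
move=> a c eq_ac; case: (ltngtP a c) => [ac|ca|/ord_inj//].
- by have := entry_mono l ac; rewrite eq_ac ltnn.
- by have := entry_mono l ca; rewrite eq_ac ltnn.
Qed.

Lemma support_set_inj : injective (@support_set k n).
Proof.
move=> l l' /setP eq_ll'; apply: val_inj; apply: val_inj => /=.
apply: (irr_sorted_eq (leT := fun i j : 'I_n => (i < j)%N)).
- by move=> x y u; apply: ltn_trans.
- by move=> x; rewrite ltnn.
- exact: (valP l).
- exact: (valP l').
- by move=> x; have := eq_ll' x; rewrite !inE.
Qed.

Lemma mem_support_set (l : schubert k n) (a : 'I_k) :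
  entry l a \in support_set l.
Proof. by rewrite inE /entry mem_tnth. Qed.

Lemma wedge_basis (i : 'I_m.+1) : injective lam ->
  wedge (\matrix_(a, c) (c == entry (lam i) a)%:R) = delta_mx 0 i.
Proof.
move=> lam_inj; apply/rowP => j; rewrite !mxE eqxx /=.
have [->|ji] := eqVneq j i.
  rewrite (_ : colsub _ _ = 1%:M) ?det1//.
  by apply/matrixP => a c; rewrite !mxE (inj_eq (@entry_inj _)) eq_sym.
have card_supp (l : schubert k n) : #|support_set l| = k.
  rewrite cardsE (card_uniqP _) ?size_tuple//.
  apply: (sorted_uniq (leT := fun i j : 'I_n => (i < j)%N)).
  - by move=> x y u; apply: ltn_trans.
  - by move=> x; rewrite ltnn.
  - exact: (valP l).
have : ~~ (support_set (lam i) \subset support_set (lam j)).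
  apply/negP => sub_ij; move: ji; rewrite eq_sym => /eqP; apply.
  apply/lam_inj/support_set_inj/eqP.
  by rewrite eqEcard sub_ij !card_supp leqnn.
case/subsetPn => x; rewrite inE => /tnthP[a ->] na.
rewrite (expand_det_row _ a) big1// => c _; rewrite !mxE.
case: eqP => [eq_a|_]; last by rewrite mul0r.
by move: na; rewrite -/(entry (lam i) a) -eq_a mem_support_set.
Qed.

(* Pl(k, n), the nonzero decomposable vectors. *)
Definition Pl : set 'rV[C]_m.+1 :=
  [set z | z != 0 /\ exists A : 'M[C]_(k, n), z = wedge A].

Definition coord_scale (x : 'I_m.+1 -> C) z : 'rV[C]_m.+1 :=
  \row_i (x i * z 0 i).

Lemma coord_scaleC x y z :
  coord_scale x (coord_scale y z) = coord_scale y (coord_scale x z).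
Proof. by apply/rowP => i; rewrite !mxE mulrCA. Qed.

(* z and w lie on the same orbit of the action of C^* with weights b.
   The weighted orbits are only compared inside Pl, so that the relation makes
   sense for all b; when b is a Pluecker weight vector, Pl is stable under the
   action and the classes are its full orbits. *)
Definition orbit_rel b : rel Pl := fun z w : Pl =>
  `[< exists2 t : C, t != 0 &
        val w = coord_scale (fun i => t ^+ b i) (val z) >].

Lemma orbit_rel_refl b : reflexive (orbit_rel b).
Proof.
move=> z; apply/asboolP; exists 1; first exact: oner_neq0.
by apply/rowP => i; rewrite mxE expr1n mul1r.
Qed.

Lemma orbit_rel_sym b : symmetric (orbit_rel b).
Proof.
suff imp (z w : Pl) : orbit_rel b z w -> orbit_rel b w z.
  by move=> z w; apply/idP/idP; apply: imp.
move=> /asboolP[t t0 eqw]; apply/asboolP; exists t^-1; first by rewrite invr_eq0.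
by apply/rowP => i; rewrite eqw !mxE exprVn mulKf// expf_neq0.
Qed.

Lemma orbit_rel_trans b : transitive (orbit_rel b).
Proof.
move=> w z u /asboolP[t t0 eqw] /asboolP[t' t'0 equ]; apply/asboolP.
exists (t' * t); first exact: mulf_neq0.
by apply/rowP => i; rewrite equ eqw !mxE exprMn mulrA.
Qed.

Definition orbit_equiv b : equiv_rel Pl :=
  EquivRel (orbit_rel b)
    (@orbit_rel_refl b) (@orbit_rel_sym b) (@orbit_rel_trans b).

(* Gr_b(k, n): the orbit space of Pl (a subspace of C^(m+1)). *)
Definition Gr b := quotient_topology {eq_quot orbit_equiv b}.

HB.instance Definition _ b := Topological.on (Gr b).
HB.instance Definition _ b := Quotient.on (Gr b).

Definition orbit_class b (z : Pl) : Gr b := \pi_(Gr b) z.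

Lemma orbit_classP b (z w : Pl) :
  reflect (orbit_class b z = orbit_class b w) (orbit_rel b z w).
Proof. by apply: (iffP idP) => [?|/eqmodP//]; apply/eqmodP. Qed.

Lemma orbit_class_repr b (p : Gr b) :
  orbit_class b (generic_quotient.repr p) = p.
Proof. exact: reprK. Qed.

Definition signs (e : 'I_m.+1 -> C) : Prop := forall i, e i = 1 \/ e i = -1.

Definition signed_perm (e : 'I_m.+1 -> C) s z : 'rV[C]_m.+1 :=
  \row_i (e i * z 0 (s i)).

Definition plucker_perm s : Prop :=
  exists e : 'I_m.+1 -> C, signs e /\ forall z, Pl z -> Pl (signed_perm e s z).

Section Scaling.
Variables (x : 'I_m.+1 -> C) (Pl_x : forall z, Pl z -> Pl (coord_scale x z)).

Lemma Pl_scale_subproof (z : Pl) : coord_scale x (val z) \in Pl.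
Proof. by apply/mem_set/Pl_x/set_mem; exact: (valP z). Qed.

Definition Pl_scale (z : Pl) : Pl := exist (fun u => u \in Pl) _ (Pl_scale_subproof z).

Definition Gr_scale b (p : Gr b) : Gr b := orbit_class b (Pl_scale (generic_quotient.repr p)).

Lemma Gr_scaleE b (z : Pl) :
  Gr_scale (orbit_class b z) = orbit_class b (Pl_scale z).
Proof.
have /orbit_classP/asboolP[t t0 eqz] := orbit_class_repr (orbit_class b z).
by apply/orbit_classP/asboolP; exists t => //; rewrite /= eqz coord_scaleC.
Qed.

End Scaling.

(* Points of the torus (C^* )^n. *)
Definition torus : Type := {t : 'I_n -> C | forall j, t j != 0}.

Definition torus_char (t : torus) (l : schubert k n) : C :=
  \prod_(a < k) sval t (entry l a).

Lemma torus_char_neq0 (t : torus) (l : schubert k n) : torus_char t l != 0.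
Proof. by apply/prodf_neq0 => a _; exact: (svalP t). Qed.

Lemma Pl_standard (t : torus) z :
  Pl z -> Pl (coord_scale (fun i => torus_char t (lam i)) z).
Proof.
move=> [z0 [A eqz]]; split.
  apply: contra z0 => /eqP/rowP eq0; apply/eqP/rowP => i.
  have /eqP := eq0 i; rewrite !mxE mulf_eq0 (negbTE (torus_char_neq0 _ _)) /=.
  by move/eqP.
exists (A *m diag_mx (\row_j sval t j)); apply/rowP => i; rewrite eqz !mxE.
have -> : colsub (entry (lam i)) (A *m diag_mx (\row_j sval t j)) =
          colsub (entry (lam i)) A *m diag_mx (\row_a sval t (entry (lam i) a)).
  by apply/matrixP => a c; rewrite !mul_mx_diag !mxE.
rewrite det_mulmx det_diag mulrC; congr (_ * _).
by apply: eq_bigr => a _; rewrite mxE.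
Qed.

Lemma signed_perm_iter e s N : signs e ->
  exists e', signs e' /\
    forall z, iter N (signed_perm e s) z = signed_perm e' (s ^+ N)%g z.
Proof.
move=> he; elim: N => [|N [e' [he' IH]]].
  exists (fun=> 1); split; first by move=> i; left.
  by move=> u; apply/rowP => i; rewrite mxE expg0 perm1 mul1r.
exists (fun i => e i * e' (s i)); split.
  move=> i; case: (he i) => ->; case: (he' (s i)) => ->;
    rewrite ?mulrNN ?mulN1r ?mulr1.
  - by left.
  - by right; rewrite mul1r.
  - by right.
  - by left.
by move=> u; rewrite iterS IH; apply/rowP => i; rewrite !mxE expgS permM mulrA.
Qed.

Lemma Pl_signed_perm_inv e s z : signs e ->
  (forall u, Pl u -> Pl (signed_perm e s u)) -> Pl z ->
  exists2 u, Pl u & z = signed_perm e s u.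
Proof.
move=> he Pe Pz; have [e' [he' itE]] := signed_perm_iter s #[s]%g he.
have Pit N : Pl (iter N (signed_perm e s) z) by elim: N => //= N; exact: Pe.
exists (iter (#[s]%g + #[s]%g).-1 (signed_perm e s) z); first exact: Pit.
rewrite -iterS prednK ?addn_gt0 ?order_gt0// iterD !itE.
apply/rowP => i; rewrite !mxE expg_order !perm1 mulrA.
by case: (he' i) => ->; rewrite ?mulrNN !mul1r.
Qed.

Lemma Pl_permuted s (hs : plucker_perm s) (t : torus) z :
  Pl z -> Pl (coord_scale (fun i => torus_char t (lam (s i))) z).
Proof.
case: hs => e [he Pe] Pz; have [u Pu ->] := Pl_signed_perm_inv he Pe Pz.
have -> : coord_scale (fun i => torus_char t (lam (s i))) (signed_perm e s u) =
          signed_perm e s (coord_scale (fun i => torus_char t (lam i)) u).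
  by apply/rowP => i; rewrite !mxE mulrCA.
by apply/Pe/Pl_standard.
Qed.

Definition standard_act b (t : torus) : Gr b -> Gr b :=
  @Gr_scale _ (@Pl_standard t) b.

Definition permuted_act s (hs : plucker_perm s) b (t : torus) : Gr b -> Gr b :=
  @Gr_scale _ (@Pl_permuted s hs t) b.

End WeightedGrassmann.

(* Main.v *)
(** A signed coordinate permutation preserving [Pl] is a homeomorphism of [Pl];
    it intertwines the two torus actions up to the permutation of characters.
    If [r c = s (sigma b)] with [r], [s] made coprime, then [c = s d] and
    [sigma b = r d], so that [t ^ b (sigma i) = u ^ c i] for all [i] as soon as
    [u ^ s = t ^ r].  Since [C^*] is divisible, the map and its inverse send
    orbits to orbits. *)
Require Import Defs.
Set Warnings "-all".
From mathcomp Require Import all_boot all_order all_algebra all_fingroup.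
From mathcomp Require Import complex.
From mathcomp Require Import all_classical all_reals all_analysis.

Section Prerequisites.
Set Implicit Arguments.
Unset Strict Implicit.
Import GRing.Theory Num.Theory.
Local Open Scope classical_set_scope.
Local Open Scope ring_scope.
Local Open Scope quotient_scope.

(** Reducing to the coprime pair [r'], [s'] matters: an arbitrary [s]-th root of [t ^+ r] would give
    the equalities only up to roots of unity. *)
Lemma proportional_powers (F : numClosedFieldType) (I : Type)
    (b c : I -> nat) (r s : nat) (t : F) :
  (0 < r)%N -> (0 < s)%N -> (forall i, r * c i = s * b i)%N -> t != 0 ->
  exists2 u : F, u != 0 & forall i, u ^+ c i = t ^+ b i.
Proof.
move=> r0 s0 rcsb t0; have g0 : (0 < gcdn r s)%N by rewrite gcdn_gt0 r0.
have r'0 : (0 < r %/ gcdn r s)%N by rewrite divn_gt0// dvdn_leq// dvdn_gcdl.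
have s'0 : (0 < s %/ gcdn r s)%N by rewrite divn_gt0// dvdn_leq// dvdn_gcdr.
have cop : coprime (s %/ gcdn r s) (r %/ gcdn r s).
  by rewrite /coprime -(eqn_pmul2r g0) muln_gcdl !divnK ?dvdn_gcdl ?dvdn_gcdr//
             mul1n gcdnC.
move: r'0 s'0 cop (divnK (dvdn_gcdl r s)) (divnK (dvdn_gcdr r s)).
move: (r %/ _)%N (s %/ _)%N => r' s' r'0 s'0 cop r'E s'E.
have rcsb' i : (r' * c i = s' * b i)%N.
  by apply/eqP; rewrite -(eqn_pmul2r g0) mulnAC r'E rcsb mulnAC s'E.
exists (s'.-root (t ^+ r')); first by rewrite rootC_eq0// expf_neq0.
(* [s'] divides [r' * c i] and is coprime to [r']. *)
move=> i; have /dvdnP[d cE] : (s' %| c i)%N.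
  by rewrite -(Gauss_dvdr _ cop) rcsb' dvdn_mulr.
have bE : b i = (r' * d)%N.
  by apply/eqP; rewrite -(eqn_pmul2l s'0) -rcsb' cE mulnA mulnC.
by rewrite cE bE mulnC exprM rootCK// exprM.
Qed.

Lemma continuous_mx (X T : topologicalType) (p q : nat)
    (f : X -> 'M[T]_(p, q)) :
  (forall i j, continuous (fun x => f x i j)) -> continuous f.
Proof.
move=> fij x A [P fxP sPA]; rewrite /nbhs/=.
have : \forall y \near x, forall i j, P i j (f y i j).
  by apply: filter_forall => i; apply: filter_forall => j; exact/fij/fxP.
by apply: filterS => y; exact: sPA.
Qed.

Context {R : realType} {k n m : nat} {lam : 'I_m.+1 -> schubert k n}.
Local Notation C := R[i].
Local Notation Pl := (Pl (R := R) lam).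
Implicit Types (e : 'I_m.+1 -> C) (sg : 'S_m.+1) (b c : 'I_m.+1 -> nat).

Lemma signed_perm_continuous e sg : continuous (@signed_perm R m e sg).
Proof.
apply: continuous_mx => i j z.
rewrite (_ : (fun _ => _) = (fun w : 'rV[C]_m.+1 => e j * w 0 (sg j))).
  apply: continuous_comp (@coord_continuous C 1 m.+1 0 (sg j) z) _.
  exact: mulrl_continuous.
by apply/funext => w; rewrite mxE.
Qed.

(** Signs are their own inverses, so inverting a signed permutation only relabels them. *)
Definition signed_perm_inv e sg (j : 'I_m.+1) : C := e (sg^-1 j)%g.

Lemma signed_permK e sg : signs e ->
  cancel (signed_perm e sg) (signed_perm (signed_perm_inv e sg) sg^-1).
Proof.
move=> he z; apply/rowP => i; rewrite !mxE permKV /signed_perm_inv mulrA.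
by case: (he (sg^-1 i)%g) => ->; rewrite ?mulrNN !mul1r.
Qed.

(** A signed permutation has finite order, so its inverse is one of its iterates and also preserves
    [Pl]. *)
Lemma Pl_signed_permV e sg (z : 'rV[C]_m.+1) : signs e ->
  (forall u, Pl u -> Pl (signed_perm e sg u)) ->
  Pl z -> Pl (signed_perm (signed_perm_inv e sg) sg^-1 z).
Proof.
move=> he Pe Pz; have [u Pu ->] := Pl_signed_perm_inv he Pe Pz.
by rewrite signed_permK.
Qed.

Section PlMap.
Variables (e : 'I_m.+1 -> C) (sg : 'S_m.+1).
Hypothesis Pe : forall z, Pl z -> Pl (signed_perm e sg z).

Definition Pl_perm (z : Pl) : Pl :=
  exist (fun u => u \in Pl) (signed_perm e sg (val z))
    (mem_set (Pe (set_mem (valP z)))).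

Lemma Pl_perm_continuous : continuous Pl_perm.
Proof.
(* [Pl] carries the subspace topology, so continuity is tested in the ambient space. *)
apply: continuous_comp_initial => z.
apply: (@continuous_comp _ _ _ (fun z : Pl => val z) (signed_perm e sg)).
  exact: initial_continuous.
exact: signed_perm_continuous.
Qed.

Lemma Pl_perm_orbit b c (r s : nat) :
  (0 < r)%N -> (0 < s)%N -> (forall i, r * c i = s * b (sg i))%N ->
  forall z w, orbit_rel b z w -> orbit_rel c (Pl_perm z) (Pl_perm w).
Proof.
move=> r0 s0 rcsb z w /asboolP[t t0 wE]; apply/asboolP.
have [u u0 uE] := proportional_powers (b := b \o sg) r0 s0 rcsb t0.
by exists u => //=; apply/rowP => i; rewrite wE !mxE uE mulrCA.
Qed.

(** Built on a chosen representative; [Gr_permE] shows that the choice is immaterial for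
    proportional weights. *)
Definition Gr_perm b c (p : Gr R lam b) : Gr R lam c :=
  orbit_class c (Pl_perm (generic_quotient.repr p)).

Section Descent.
Variables (b c : 'I_m.+1 -> nat) (r s : nat).
Hypotheses (r0 : (0 < r)%N) (s0 : (0 < s)%N).
Hypothesis rcsb : forall i, (r * c i = s * b (sg i))%N.

Lemma Gr_permE z :
  Gr_perm c (orbit_class b z) = orbit_class c (Pl_perm z).
Proof.
by apply/orbit_classP/(Pl_perm_orbit r0 s0 rcsb) => //; apply/orbit_classP;
  rewrite orbit_class_repr.
Qed.

Lemma Gr_perm_continuous : continuous (@Gr_perm b c).
Proof.
(* A map out of a quotient is continuous once its composite with the projection is. *)
apply/quotient_continuous.
rewrite (_ : _ \o _ = (\pi_(Gr R lam c) : Pl -> _) \o Pl_perm); last first.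
  by apply/funext => z; exact: Gr_permE.
move=> z; apply: continuous_comp; first exact: Pl_perm_continuous.
exact: pi_continuous.
Qed.

End Descent.

End PlMap.

End Prerequisites.

Theorem theoremA (R : realType) (k n m : nat) (lam : 'I_m.+1 -> schubert k n)
    (b c : 'I_m.+1 -> nat) (sigma : 'S_m.+1) (r s : nat)
    (hk : (1 <= k)%N) (hkn : (k < n)%N) (hm : m.+1 = 'C(n, k))
    (hlam : schubert_order lam)
    (hb : plucker_weight lam b) (hc : plucker_weight lam c)
    (hsigma : plucker_perm R lam sigma)
    (hr : (0 < r)%N) (hs : (0 < s)%N)
    (hrs : forall i : 'I_m.+1, (r * c i = s * b (sigma i))%N) :
  exists f : Gr R lam b -> Gr R lam c,
    homeomorphism f /\
    forall (t : torus R n) (p : Gr R lam b),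
      f (standard_act t p) = permuted_act hsigma t (f p).
Proof.
have [e [he Pe]] := hsigma.
pose Pe' z := @Pl_signed_permV R k n m lam e sigma z he Pe.
(* The same relation read backwards makes the inverse signed permutation descend from [c] to [b]. *)
have hsr i : (s * b i = r * c (sigma^-1 i)%g)%N by rewrite hrs permKV.
have fE := Gr_permE Pe hr hs hrs.
have gE := Gr_permE Pe' hs hr hsr.
exists (Gr_perm Pe c); split.
  split; first exact: (Gr_perm_continuous hr hs hrs).
  exists (Gr_perm Pe' b); split.
  - move=> p; rewrite -(orbit_class_repr p) fE gE; congr orbit_class.
    by apply: val_inj; exact: signed_permK.
  - move=> p; rewrite -(orbit_class_repr p) gE fE; congr orbit_class.
    apply: val_inj => /=.
    (* Writing the point as an image under [signed_perm e sigma] reduces this cancellation to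
       [signed_permK]. *)
    have [u _ ->] := Pl_signed_perm_inv he Pe (set_mem (valP (generic_quotient.repr p))).
    by rewrite signed_permK.
  - exact: (Gr_perm_continuous hs hr hsr).
move=> t p; rewrite -(orbit_class_repr p) /standard_act /permuted_act.
rewrite Gr_scaleE !fE Gr_scaleE; congr orbit_class; apply: val_inj => /=.
(* In each coordinate the sign commutes with the character of [lam (sigma i)]. *)
by apply/matrixP => i j; rewrite !mxE GRing.mulrCA.
Qed.
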